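(* Let $C\subset\mathbb{R}^2$ be a compact region of area $A$, let $W_j\subset C$ be a compact region and let $x_i\in\mathbb{R}^2$ be a sensor position. Let $P>0$, $d_0>0$, $\beta>2$, let $0<P_{r_i}<P$, and put $r_i=\big((\tfrac{P}{P_{r_i}}-1)d_0\big)^{1/\beta}$. In the noise-free limit, the conditional probability density satisfies $$p(\ln P_{r_i}\mid y\in W_j)\,P(y\in W_j)=\frac1A\int_{W_j}\delta\Big(\ln P_{r_i}-\ln\frac{Pd_0}{d_0+\|x_i-y\|^{\beta}}\Big)\,dy_2\,dy_1$$ and $$p(\ln P_{r_i}\mid y\in W_j)\,P(y\in W_j)=\frac{d_0+r_i^{\beta}}{A\,\beta\, r_i^{\beta-2}}\;\theta(W_j,r_i,x_i).$$
   Context: A source at $y=[y_1,y_2]^T$, with prior density uniform on $C$ (equal to $1/A$), produces at sensor $i$ the measurement $\ln P_{r_i}=\ln\frac{Pd_0}{d_0+\|x_i-y\|^\beta}+n_i$ with $n_i$ Gaussian noise of mean $0$ and variance $\sigma^2$. In the limit of vanishing variance the conditional density of the measurement given $y$ is the Dirac delta $p(\ln P_{r_i}\mid y)=\delta\big(\ln P_{r_i}-\ln\frac{Pd_0}{d_0+\|x_i-y\|^{\beta}}\big)$; by the uniform prior, $p(\ln P_{r_i}\mid y\in W_j)P(y\in W_j)=\frac1A\int_{W_j}p(\ln P_{r_i}\mid y)\,dy$. Interpretation of the delta integral: the integral over $W_j$ is the iterated integral over $y_1$ and then, for fixed $y_1=a$, over the section $\{y_2: [a,y_2]\in W_j\}$.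 The inner integral is evaluated by the rule $\delta[g(x)]=\sum_{\gamma\in\Gamma}\delta(x-x_\gamma)/|g'(x_\gamma)|$ for a differentiable $g$ vanishing at the points $x_\gamma$, $\gamma\in\Gamma$. That is, it equals the sum of $1/|g'(y_2)|$ over zeros $y_2$ of $g(y_2)=\ln P_{r_i}-\ln\frac{Pd_0}{d_0+\|x_i-[a,y_2]^T\|^{\beta}}$ lying in the section; the finitely many (null set of) values $a$ for which $g'$ vanishes at a zero are ignored. Let $C(r,x_i)=\{y\in\mathbb{R}^2: \|y-x_i\|=r\}$ and $S(W_j,r,x_i)=C(r,x_i)\cap W_j$, which is a union of arcs of the circle $C(r,x_i)$. $\theta(W_j,r,x_i)$ is the sum of the angles (in radians, at the center $x_i$) subtended by these arcs, i.e. the total angular measure of $S(W_j,r,x_i)$. *)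

(* Defs.v *)
From mathcomp Require Import all_boot all_order all_algebra.
From mathcomp Require Import all_classical all_reals all_analysis.
Set Implicit Arguments.
Unset Strict Implicit.
Unset Printing Implicit Defensive.
Import Order.TTheory GRing.Theory Num.Theory.
Import numFieldNormedType.Exports.
Local Open Scope classical_set_scope.
Local Open Scope ring_scope.

Section Definitions.
Context {R : realType}.
Implicit Types (x y : R * R) (C W : set (R * R)) (g f : R * R -> R).

(* The norm that the library puts on R * R is the sup norm. *)
Definition eucl_dist x y : R :=
  Num.sqrt ((x.1 - y.1) ^+ 2 + (x.2 - y.2) ^+ 2).

Definition area : set (R * R) -> \bar R :=
  (@lebesgue_measure R \x @lebesgue_measure R)%E.

(* A region has positive area; in particular the uniform density on it and
   conditioning on lying in it make sense. *)
Definition compact_region C : Prop := compact C /\ (0 < area C)%E.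

Definition uniform_density C y : R := \1_C y / fine (area C).

(* P(y \in W) for a source y with the uniform prior on C. *)
Definition prior_prob C W : \bar R :=
  (\int[(@lebesgue_measure R \x @lebesgue_measure R)%E]_(y in W)
     (uniform_density C y)%:E)%E.

(* The noise-free measurement at the sensor x of a source at y. *)
Definition log_power (P d0 beta : R) x y : R :=
  ln (P * d0 / (d0 + eucl_dist x y `^ beta)).

(* The derivative of g in its second variable. *)
Definition deriv2 g y : R := derive1 (fun b => g (y.1, b)) y.2.

(* The first coordinates a such that b |-> g (a, b) has only simple zeros. *)
Definition simple_zeros g : set R :=
  [set a | forall b, g (a, b) = 0 -> deriv2 g (a, b) != 0].

(* The iterated integral
     \int dy1 \int_(y2 | (y1, y2) \in W) delta(g (y1, y2)) f (y1, y2) dy2,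
   the inner one being evaluated by the rule
     delta(h(t)) = \sum_(s | h(s) = 0) delta(t - s) / |h'(s)|,
   and the values of y1 for which this rule is not applicable (h' vanishes at a
   zero of h) being discarded. *)
Definition delta_integral W g f : \bar R :=
  (\int[@lebesgue_measure R]_(a in simple_zeros g)
     \esum_(b in [set b | W (a, b) /\ g (a, b) = 0%R])
       (f (a, b) / `|deriv2 g (a, b)|)%:E)%E.

(* The conditional density p(z | y \in W) of the noise-free measurement, i.e.
     (\int_W p(z | y) p(y) dy) / P(y \in W)
   where p(y) is the uniform prior on C and where the likelihood p(z | y) is
   delta(z - log_power P d0 beta x y), the limit of the Gaussian density of
   mean log_power P d0 beta x y when the variance vanishes. *)
Definition cond_density (P d0 beta : R) C x W (z : R) : \bar R :=
  (delta_integral W (fun y => z - log_power P d0 beta x y)%R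
     (uniform_density C) / prior_prob C W)%E.

Definition circle (r : R) x : set (R * R) := [set y | eucl_dist y x = r].

Definition arcs W (r : R) x : set (R * R) := circle r x `&` W.

(* Total angular measure, in radians, of the arcs of W on the circle. *)
Definition theta W (r : R) x : \bar R :=
  lebesgue_measure
    [set t : R | 0 <= t < 2 * pi /\
                 arcs W r x (x.1 + r * cos t, x.2 + r * sin t)].

End Definitions.

(* Main.v *)
Require Import Defs.
From HB Require Import structures.
From mathcomp Require Import all_boot all_order all_algebra.
From mathcomp Require Import all_classical all_reals all_analysis.
From mathcomp Require Import measurable_realfun.
From mathcomp Require Import ring lra.
Set Implicit Arguments.
Unset Strict Implicit.
Unset Printing Implicit Defensive.
Import Order.TTheory GRing.Theory Num.Theory.
Import numFieldNormedType.Exports.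
Local Open Scope classical_set_scope.
Local Open Scope ring_scope.

(** Put [c = x.1] and [s a = sqrt (r ^+ 2 - (a - c) ^+ 2)], half the length of
    the chord that the vertical line at abscissa [a] cuts in the disc.

    The argument [g] of the delta vanishes exactly on the circle of radius [r]
    about the sensor ([log_power_zero]), and there its derivative in the second
    variable is [(y.2 - x.2) / K] with [K = (d0 + r^beta) / (beta r^(beta - 2))]
    ([log_power_deriv2]).  So the zeros on the line at abscissa [a] are the two
    points of ordinate [x.2 + s a] and [x.2 - s a], each of weight [K / s a],
    and the delta integral is [K] times the integral of [1 / s] over the
    abscissae of the upper arcs plus the same over those of the lower arcs
    ([inner_delta]).

    Now [da / s a] is the angle element in the chart [a = c + r cos t], because
    [- acos ((a - c) / r)] is a primitive of [1 / s].  As the arcs are cut out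
    by an arbitrary closed set, this substitution is needed for indicators of
    Borel sets: the image under [c + r cos t] of Lebesgue measure on a half turn
    and the measure of density [1 / s] are compared on half-lines, which generate
    the Borel sets ([arc_length_change_of_variable]).  The two half turns
    together give [theta] ([theta_shadows]).

    Finally the conditional density is the delta integral of the constant [1/A]
    over [W] divided by [P(y \in W) = area W / A]; the latter is finite and
    positive, so multiplying by it cancels the division.  Both equalities are
    then instances of [delta_integral_circle], for the constants [1/A] and [1]. *)

(** * Borel sets of the plane *)

(** The sigma-algebra of the plane is generated by rectangles: an open set is
    the union of the squares of rational centre and radius [1/(n+1)] that it
    contains, and there are countably many of these. *)
Lemma open_measurable_prod {R : realType} (U : set (R * R)) :
  open U -> measurable U.
Proof.
move=> oU.
pose B (c : (rat * rat) * nat) : set (R * R) :=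
  ball (ratr c.1.1 : R) (c.2.+1%:R^-1) `*` ball (ratr c.1.2 : R) (c.2.+1%:R^-1).
have mB c : measurable (B c).
  by apply: measurableX; apply: open_measurable; exact: ball_open.
have -> : U = \bigcup_c (if asbool (B c `<=` U) then B c else set0).
  apply/seteqP; split => [y Uy|y [c _ yc]]; last first.
    by move: yc; case: asboolP => [+ Bcy|_ []]; exact.
  move: (oU _ Uy); rewrite -nbhs_ballE => -[e /= e0 yeU].
  have e20 : 0 < e / 2 by rewrite divr_gt0.
  have [n ne] : exists n : nat, n.+1%:R^-1 < e / 2.
    have [N _ /(_ N (leqnn _)) /= h] := @near_infty_natSinv_lt R (PosNum e20).
    by exists N.
  have n0 : 0 < n.+1%:R^-1 :> R by rewrite invr_gt0.
  have ne2 : n.+1%:R^-1 + n.+1%:R^-1 <= e by rewrite [e]splitr lerD// ltW.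
  have rat_near (z : R) : exists q : rat, ball z (n.+1%:R^-1) (ratr q).
    have [|u [/= zq [q _ uE]]] := @dense_rat R (ball z n.+1%:R^-1) _ (ball_open _ _).
      by exists z; exact: ballxx.
    by exists q; rewrite uE.
  have [[p yp] [q yq]] := (rat_near y.1, rat_near y.2).
  exists ((p, q), n) => //.
  rewrite asboolT /=; first by split; exact: ball_sym.
  move=> z [/= z1 z2]; apply: yeU; split => /=; apply: le_ball ne2 _ _.
    exact: ball_triangle z1.
  exact: ball_triangle z2.
apply: countable_bigcupT_measurable => // c.
by case: asboolP.
Qed.

Lemma compact_closed_measurable_prod {R : realType} (C : set (R * R)) :
  compact C -> closed C /\ measurable C.
Proof.
move=> cC; have clC : closed C by apply: compact_closed cC; exact: norm_hausdorff.
split => //; rewrite -[C]setCK; apply: measurableC.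
by apply: open_measurable_prod; exact: closed_openC.
Qed.

(** * The angle element of a circle in terms of the abscissa *)

Section arc_length_density.
Context {R : realType}.
Variables (r c : R).
Hypothesis r_gt0 : 0 < r.
Local Notation mu := (@lebesgue_measure R).

Definition half_chord (a : R) : R := Num.sqrt (r ^+ 2 - (a - c) ^+ 2).

(** The angle swept on either half circle per unit of abscissa.  Square root
    and inverse being total, it is [0] for [a] outside the open interval
    [(c - r, c + r)], so integrals need no restriction to that interval. *)
Definition arc_density (a : R) : R := (half_chord a)^-1.

Lemma arc_density_ge0 a : 0 <= arc_density a.
Proof. by rewrite invr_ge0 sqrtr_ge0. Qed.

Lemma half_chord_gt0 a : c - r < a < c + r -> 0 < half_chord a.
Proof.
by move=> /andP[? ?]; rewrite sqrtr_gt0 subr_sqr mulr_gt0//; lra.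
Qed.

Lemma arc_density_out a : ~~ (c - r < a < c + r) -> arc_density a = 0.
Proof.
move=> aD; rewrite /arc_density /half_chord ler0_sqrtr ?invr0//.
have rp := r_gt0; rewrite subr_sqr.
move: aD; rewrite negb_and -!leNgt => /orP[|] ?.
  by rewrite mulr_ge0_le0//; lra.
by rewrite mulr_le0_ge0//; lra.
Qed.

Lemma continuous_half_chord : continuous half_chord.
Proof.
move=> a; apply: continuous_comp; last exact: sqrt_continuous.
apply: cvgB; first exact: cvg_cst.
apply: (@continuous_comp _ _ _ (fun a : R => a - c) (fun y : R => y ^+ 2)).
  by apply: cvgB => //; exact: cvg_cst.
exact: exprn_continuous.
Qed.

Lemma measurable_arc_density : measurable_fun setT arc_density.
Proof.
(* The inverse is discontinuous at 0, hence the detour through real powers. *)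
rewrite (_ : arc_density = (fun y : R => y `^ (-1)) \o half_chord).
  apply: measurableT_comp; first exact: measurable_powR.
  by apply: continuous_measurable_fun; exact: continuous_half_chord.
by apply/funext => a /=; rewrite powR_inv1 ?sqrtr_ge0.
Qed.

Definition arc_measure (B : set (measurableTypeR R)) : \bar R :=
  (\int[mu]_(a in B) (arc_density a)%:E)%E.

Let arc_measure0 : arc_measure set0 = 0%E.
Proof. by rewrite /arc_measure integral_set0. Qed.

Let arc_measure_ge0 B : (0 <= arc_measure B)%E.
Proof. by apply: integral_ge0 => a _; rewrite lee_fin arc_density_ge0. Qed.

Let arc_measure_sigma_additive : semi_sigma_additive arc_measure.
Proof.
move=> F mF tF mUF; rewrite /arc_measure; apply: cvg_toP.
  apply: ereal_nondecreasing_is_cvgn => m n mn.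
  by apply: lee_sum_nneg_natr => // k _ _; exact: arc_measure_ge0.
rewrite ge0_integral_bigcup//=.
  by apply/measurable_funTS/measurable_EFinP; exact: measurable_arc_density.
by move=> a _; rewrite lee_fin arc_density_ge0.
Qed.

HB.instance Definition _ := isMeasure.Build _ _ _ arc_measure
  arc_measure0 arc_measure_ge0 arc_measure_sigma_additive.

Lemma arc_cos_itv p : c - r < p < c + r -> -1 < (p - c) / r < 1.
Proof.
by move=> /andP[? ?]; rewrite ltr_pdivrMr// ltr_pdivlMr//; apply/andP; split; lra.
Qed.

Lemma is_derive_acos_arc a : c - r < a < c + r ->
  is_derive a 1 (fun a => - acos ((a - c) / r)) (arc_density a).
Proof.
move=> aD.
have h : is_derive a 1 (fun a : R => (a - c) / r) (r^-1).
  by apply: is_derive_eq; rewrite subr0 /GRing.scale/=; ring.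
have := @is_derive1_comp R (@acos R) _ a _ _ (is_derive1_acos (arc_cos_itv aD)) h.
move=> /is_deriveN.
rewrite [X in is_derive _ _ _ X](_ : _ = arc_density a)//.
rewrite mulNr opprK -invfM; congr (_^-1).
rewrite -[X in _ * X](ger0_norm (ltW r_gt0)) -sqrtr_sqr -sqrtrM; last first.
  by have := arc_cos_itv aD; move: ((a - c) / r) => u ?; nra.
by congr Num.sqrt; field; rewrite gt_eqF.
Qed.

Lemma integral_arc_density p q : c - r < p -> p <= q -> q < c + r ->
  (\int[mu]_(a in `[p, q]) (arc_density a)%:E
   = (acos ((p - c) / r) - acos ((q - c) / r))%:E)%E.
Proof.
move=> pD; rewrite le_eqVlt => /predU1P[-> _|pq qD].
  by rewrite set_itv1 integral_set1 subrr.
have inD a : a \in `[p, q] -> c - r < a < c + r.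
  by rewrite in_itv/= => /andP[? ?]; apply/andP; split; lra.
pose F a := - acos ((a - c) / r).
have dF a : a \in `[p, q] -> is_derive a 1 F (arc_density a).
  by move=> /inD; exact: is_derive_acos_arc.
have cF a : a \in `[p, q] -> {for a, continuous F}.
  by move=> /dF[d _]; apply: differentiable_continuous; exact/derivable1_diffP.
rewrite (@continuous_FTC2 _ _ F)//.
- by rewrite -EFinB opprK addrC.
- apply: continuous_in_subspaceT => a /[1!inE] aI.
  apply: (@continuousV R R half_chord); last exact: continuous_half_chord.
  by rewrite gt_eqF// half_chord_gt0// inD.
- split.
  + by move=> a /subset_itv_oo_cc/dF[].
  + by apply: cvg_at_right_filter; apply: cF; rewrite in_itv/= lexx ltW.
  + by apply: cvg_at_left_filter; apply: cF; rewrite in_itv/= lexx ltW.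
- by move=> a /subset_itv_oo_cc/dF[_]; rewrite derive1E.
Qed.

(** Both sides are finite measures in [B], so it suffices that they agree on the
    half-lines [[q, +oo[].  Both are concentrated on [(c - r, c + r)], where they
    agree on compact intervals by hypothesis; continuity from below along
    compact intervals exhausting [[q, +oo[ `&` (c - r, c + r)] deals with the
    unboundedness of the density at the endpoints. *)
Lemma arc_length_change_of_variable (J : set R) :
  measurable J -> (mu J < +oo)%E ->
  (forall t, J t -> c - r < c + r * cos t < c + r) ->
  (forall p q, c - r < p -> p <= q -> q < c + r ->
     mu (J `&` [set t | p <= c + r * cos t <= q])
     = (acos ((p - c) / r) - acos ((q - c) / r))%:E) ->
  forall B, measurable B ->
    mu (J `&` [set t | B (c + r * cos t)])
    = (\int[mu]_(a in B) (arc_density a)%:E)%E.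
Proof.
move=> mJ Jfin JD Jitv B mB.
pose phi (t : R) : R := c + r * cos t.
have mphi : measurable_fun setT phi.
  apply: continuous_measurable_fun => t; apply: cvgD; first exact: cvg_cst.
  by apply: cvgM; [exact: cvg_cst|exact: continuous_cos].
pose m1 := pushforward (mrestr mu mJ) (phi : measurableTypeR R -> measurableTypeR R).
have m1E A : m1 A = mu (J `&` [set t | A (phi t)]).
  by rewrite /m1 /pushforward /mrestr setIC.
rewrite -m1E -/(arc_measure B).
have m1fin A : measurable A -> (m1 A < +oo)%E.
  move=> mA; rewrite m1E (le_lt_trans _ Jfin)// le_measure ?inE//.
  by apply: measurableI => //; rewrite -[X in measurable X]setTI; exact: mphi.
have arc_measureD q :
    arc_measure `[q, +oo[ = arc_measure (`[q, +oo[ `&` `]c - r, c + r[).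
  rewrite /arc_measure integral_mkcondr; apply: eq_integral => a _.
  rewrite patchE; case: ifPn => //; rewrite notin_setE/= in_itv/= => /negP.
  by move=> /arc_density_out ->.
have m1_ray q : m1 `[q, +oo[%classic = arc_measure `[q, +oo[.
  rewrite arc_measureD.
  pose F n : set R := `[Num.max q (c - r + n.+1%:R^-1), c + r - n.+1%:R^-1]%classic.
  have FE : `[q, +oo[ `&` `]c - r, c + r[ = \bigcup_n F n.
    apply/seteqP; split => a/=; rewrite !in_itv/= ?andbT.
      move=> [qa /andP[ca ac]].
      have d_gt0 : 0 < Num.min (a - (c - r)) (c + r - a) by rewrite lt_min !subr_gt0 ca.
      have [N _ /(_ N (leqnn _))/=] := @near_infty_natSinv_lt R (PosNum d_gt0).
      rewrite lt_min/= => /andP[? ?].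
      exists N => //; rewrite /F/= in_itv/= ge_max qa/=; apply/andP; split.
        by rewrite -lerBrDl ltW.
      by rewrite lerBrDl -lerBrDr ltW.
    move=> [n _]; rewrite /F/= in_itv/= ge_max => /andP[/andP[-> ca] ac]; split => //.
    have n0 : 0 < n.+1%:R^-1 :> R by rewrite invr_gt0.
    by rewrite (lt_le_trans _ ca) ?ltrDl//= (le_lt_trans ac)// gtrBl.
  have ndF : nondecreasing_seq F.
    move=> m n mn; apply/subsetPset => a; rewrite /F/= !in_itv/= !ge_max.
    have : n.+1%:R^-1 <= m.+1%:R^-1 :> R by rewrite lef_pV2 ?posrE// ler_nat.
    move=> nm /andP[/andP[-> ca] ac]/=.
    by rewrite (le_trans _ ca) ?lerD2l//= (le_trans ac)// lerB.
  have mF n : measurable (F n) by exact: measurable_itv.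
  have m1F n : m1 (F n) = arc_measure (F n).
    have n0 : 0 < n.+1%:R^-1 :> R by rewrite invr_gt0.
    have [pq|qp] := leP (Num.max q (c - r + n.+1%:R^-1)) (c + r - n.+1%:R^-1).
      have pD : c - r < Num.max q (c - r + n.+1%:R^-1) by rewrite lt_max ltrDl n0 orbT.
      have qD : c + r - n.+1%:R^-1 < c + r by rewrite gtrBl.
      by rewrite m1E /arc_measure integral_arc_density// -Jitv//.
    have -> : F n = set0.
      rewrite -subset0 => a; rewrite /F/= in_itv/= => /andP[/le_trans]/[apply].
      by rewrite leNgt qp.
    by rewrite arc_measure0 m1E (_ : [set t | _] = set0) ?setI0 ?measure0.
  have -> : m1 `[q, +oo[%classic = m1 (\bigcup_n F n).
    rewrite -FE !m1E; congr (mu _); apply/seteqP.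
    split => t/= [Jt]; rewrite !in_itv/= andbT; last by case.
    by move=> qt; split=> //; split => //; exact: JD.
  have mUF : measurable (\bigcup_n F n) by exact: bigcupT_measurable.
  rewrite FE.
  have /cvg_lim <- // := @nondecreasing_cvg_mu _ _ _ arc_measure F mF mUF ndF.
  symmetry; apply/cvg_lim => //.
  rewrite (_ : arc_measure \o F = m1 \o F); last by apply/funext => n /=; rewrite m1F.
  by apply: nondecreasing_cvg_mu.
(* The pushforward is a measure only for measurable phi: M1 is a function of the
   proof of measurability. *)
pose M1 : {measure set (measurableTypeR R) -> \bar R} := m1.
pose M2 : {measure set (measurableTypeR R) -> \bar R} := arc_measure.
apply: (@measure_unique _ R (measurableTypeR R) (@RGenCInfty.G R)
  (fun n => `[- n%:R, +oo[%classic) (RGenCInfty.measurableE R)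
   _ _ _ (M1 mphi) M2 _ _ B mB) => //=.
- move=> _ _ [p ->] [q ->]; exists (Num.max p q); apply/seteqP.
  split => a/=; rewrite !in_itv/= !andbT ge_max; last by move=> /andP[].
  by case=> -> ->.
- by move=> n; exists (- n%:R).
- apply/seteqP; split => // a _; exists (Num.truncn `|a|).+1 => //=.
  rewrite in_itv/= andbT lerNl.
  by rewrite (le_trans (ler_norm _))// normrN ltW// truncnS_gt.
- by move=> _ [q ->].
- by move=> n; apply: m1fin; exact: measurable_itv.
Qed.

(** * The two half turns *)

Let acos_itv p : c - r < p < c + r -> 0 < acos ((p - c) / r) < pi.
Proof.
move=> /arc_cos_itv/andP[? ?].
by rewrite acos_gt0 ?acos_ltpi// ltW ?andbT//=; lra.
Qed.

Let cos_acos_arc p : c - r < p < c + r -> c + r * cos (acos ((p - c) / r)) = p.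
Proof.
move=> /arc_cos_itv/andP[? ?]; rewrite acosK; last by rewrite in_itv/= !ltW.
by field; rewrite gt_eqF.
Qed.

Let lt_cos_arc t u : 0 <= t <= pi -> 0 <= u <= pi ->
  (c + r * cos t < c + r * cos u) = (u < t).
Proof. by move=> ? ?; rewrite ltrD2l ltr_pM2l// ltr_cos. Qed.

Let cos_arc_between p q t : c - r < p -> p <= q -> q < c + r -> 0 < t < pi ->
  (p <= c + r * cos t <= q) =
  (acos ((q - c) / r) <= t <= acos ((p - c) / r)).
Proof.
move=> pD pq qD /andP[t0 tpi].
have pD' : c - r < p < c + r by rewrite pD (le_lt_trans pq).
have qD' : c - r < q < c + r by rewrite qD (lt_le_trans pD).
have /andP[/ltW ? /ltW ?] := acos_itv pD'.
have /andP[/ltW ? /ltW ?] := acos_itv qD'.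
rewrite -{1}(cos_acos_arc pD') -{1}(cos_acos_arc qD') !leNgt.
rewrite !lt_cos_arc ?(ltW t0) ?(ltW tpi)//; try exact/andP.
by rewrite andbC.
Qed.

Let acos_le p q : c - r < p -> p <= q -> q < c + r ->
  acos ((q - c) / r) <= acos ((p - c) / r).
Proof.
move=> pD pq qD.
have pD' : c - r < p < c + r by rewrite pD (le_lt_trans pq).
have qD' : c - r < q < c + r by rewrite qD (lt_le_trans pD).
have /andP[/ltW ? /ltW ?] := acos_itv pD'.
have /andP[/ltW ? /ltW ?] := acos_itv qD'.
rewrite leNgt -lt_cos_arc ?cos_acos_arc//; try exact/andP.
by rewrite -leNgt.
Qed.

Let cos_arc_range t : 0 < t < pi -> c - r < c + r * cos t < c + r.
Proof.
move=> /andP[t0 tpi]; have pi0 := pi_ge0 R.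
have cpi : c - r = c + r * cos pi by rewrite cospi mulrN1.
have c0 : c + r = c + r * cos 0 by rewrite cos0 mulr1.
by apply/andP; split; [rewrite cpi|rewrite c0];
  rewrite lt_cos_arc ?lexx ?pi0 ?(ltW t0) ?(ltW tpi).
Qed.

Let cos_2piB (t : R) : cos (2 * pi - t) = cos t.
Proof. by rewrite addrC mulr_natl cosD2pi cosN. Qed.

Lemma upper_half_circle (B : set R) : measurable B ->
  mu (`]0, pi[ `&` [set t | B (c + r * cos t)])
  = (\int[mu]_(a in B) (arc_density a)%:E)%E.
Proof.
apply: arc_length_change_of_variable => //.
- by rewrite lebesgue_measure_itv/= lte_fin; case: ifPn => // _; rewrite ltry.
- move=> p q pD pq qD.
  have pD' : c - r < p < c + r by rewrite pD (le_lt_trans pq).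
  have qD' : c - r < q < c + r by rewrite qD (lt_le_trans pD).
  have /andP[? ?] := acos_itv pD'; have /andP[? ?] := acos_itv qD'.
  rewrite (_ : _ `&` _ = `[acos ((q - c) / r), acos ((p - c) / r)]%classic).
    have h := acos_le pD pq qD.
    rewrite lebesgue_measure_itv/= lte_fin.
    by case: ltP => h'; rewrite -?EFinB; congr EFin; lra.
  apply/seteqP; split => t/=; rewrite !in_itv/=.
    by move=> [t0]; rewrite cos_arc_between.
  move=> /andP[qt tp]; have tD : 0 < t < pi by apply/andP; split; lra.
  by split=> //; rewrite cos_arc_between// qt.
Qed.

(** The reflection [t |-> 2 pi - t] exchanges the two half turns and preserves
    the abscissa [c + r cos t]. *)
Lemma lower_half_circle (B : set R) : measurable B ->
  mu (`]pi, 2 * pi[ `&` [set t | B (c + r * cos t)])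
  = (\int[mu]_(a in B) (arc_density a)%:E)%E.
Proof.
apply: arc_length_change_of_variable => //.
- by rewrite lebesgue_measure_itv/= lte_fin; case: ifPn => // _; rewrite ltry.
- move=> t; rewrite /= in_itv/= -cos_2piB => /andP[? ?].
  by apply: cos_arc_range; apply/andP; split; lra.
- move=> p q pD pq qD.
  have pD' : c - r < p < c + r by rewrite pD (le_lt_trans pq).
  have qD' : c - r < q < c + r by rewrite qD (lt_le_trans pD).
  have /andP[? ?] := acos_itv pD'; have /andP[? ?] := acos_itv qD'.
  rewrite (_ : _ `&` _ =
    `[2 * pi - acos ((p - c) / r), 2 * pi - acos ((q - c) / r)]%classic).
    have h := acos_le pD pq qD.
    rewrite lebesgue_measure_itv/= lte_fin.
    by case: ltP => h'; rewrite -?EFinB; congr EFin; lra.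
  apply/seteqP; split => t/=; rewrite !in_itv/= -cos_2piB.
    move=> [/andP[? ?]]; rewrite cos_arc_between//; last by apply/andP; split; lra.
    by move=> /andP[? ?]; apply/andP; split; lra.
  move=> /andP[qt tp]; split; first by apply/andP; split; lra.
  by rewrite cos_arc_between//; apply/andP; split; lra.
Qed.

End arc_length_density.

(** * The angular measure of the arcs as an integral over abscissae *)

Section angular_measure.
Context {R : realType}.
Variables (W : set (R * R)) (r : R) (x : R * R).
Hypotheses (W_closed : closed W) (r_gt0 : 0 < r).
Local Notation mu := (@lebesgue_measure R).
Local Notation s := (half_chord r x.1).

(** For [|a - x.1| <= r], the abscissae of the points of [W] on the upper half
    circle.  Further away [s a = 0] and the condition is that [(a, x.2)] lies in
    [W], which is harmless because [arc_density] vanishes there. *)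
Definition upper_shadow : set R := [set a | W (a, x.2 + s a)].
Definition lower_shadow : set R := [set a | W (a, x.2 - s a)].

Lemma half_chord_cos t : s (x.1 + r * cos t) = r * `|sin t|.
Proof.
rewrite /half_chord addrAC subrr add0r.
rewrite (_ : r ^+ 2 - (r * cos t) ^+ 2 = (r * sin t) ^+ 2); last first.
  by rewrite !exprMn sin2cos2; ring.
by rewrite sqrtr_sqr normrM gtr0_norm.
Qed.

Lemma measurable_upper_shadow : measurable upper_shadow.
Proof.
apply: closed_measurable.
rewrite /upper_shadow -[X in closed X]/((fun a => (a, x.2 + s a)) @^-1` W).
apply: preimage_closed => // a _.
have h : x.2 + s b @[b --> a] --> x.2 + s a.
  by apply: cvgD; [exact: cvg_cst|exact: continuous_half_chord].
exact: (cvg_pair cvg_id h).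
Qed.

Lemma measurable_lower_shadow : measurable lower_shadow.
Proof.
apply: closed_measurable.
rewrite /lower_shadow -[X in closed X]/((fun a => (a, x.2 - s a)) @^-1` W).
apply: preimage_closed => // a _.
have h : x.2 - s b @[b --> a] --> x.2 - s a.
  by apply: cvgB; [exact: cvg_cst|exact: continuous_half_chord].
exact: (cvg_pair cvg_id h).
Qed.

Lemma circle_cos_sin t : circle r x (x.1 + r * cos t, x.2 + r * sin t).
Proof.
rewrite /circle/= /eucl_dist/= (addrC x.1) (addrC x.2) !addrK.
by rewrite !exprMn -mulrDr cos2Dsin2 mulr1 sqrtr_sqr gtr0_norm.
Qed.

(** The ordinate of the point at angle [t] is [x.2 + s a] or [x.2 - s a]
    according to the sign of [sin t]; the angles [0] and [pi] are negligible. *)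
Lemma theta_shadows :
  (theta W r x = \int[mu]_(a in upper_shadow) (arc_density r x.1 a)%:E
               + \int[mu]_(a in lower_shadow) (arc_density r x.1 a)%:E)%E.
Proof.
have pi0 := pi_gt0 R.
have mU := measurable_upper_shadow; have mL := measurable_lower_shadow.
rewrite -upper_half_circle// -lower_half_circle//.
set U := _ `&` _; set L := _ `&` _.
pose inW t := arcs W r x (x.1 + r * cos t, x.2 + r * sin t).
pose E : set R := [set t | (t = 0 \/ t = pi) /\ inW t].
have cE : countable E.
  apply: (@sub_countable _ _ _ [set 0; pi]); last exact: finite_set_countable.
  by apply: subset_card_le => t [].
have mphi : measurable_fun setT (fun t : R => x.1 + r * cos t).
  apply: continuous_measurable_fun => t; apply: cvgD; first exact: cvg_cst.
  by apply: cvgM; [exact: cvg_cst|exact: continuous_cos].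
have mU' : measurable U.
  by apply: measurableI => //; rewrite -[X in measurable X]setTI; exact: mphi.
have mL' : measurable L.
  by apply: measurableI => //; rewrite -[X in measurable X]setTI; exact: mphi.
have UE : U = [set t | 0 < t < pi /\ inW t].
  apply/seteqP; split => t; rewrite /U/= in_itv/= /upper_shadow/= half_chord_cos.
    move=> [t0 +]; rewrite gtr0_norm ?sin_gt0_pi// => ?.
    by split => //; split => //; exact: circle_cos_sin.
  by move=> [t0 []]; rewrite gtr0_norm ?sin_gt0_pi.
have sin_lt0 t : pi < t < 2 * pi -> sin t < 0.
  move=> /andP[? ?]; rewrite -oppr_gt0 -sinN.
  by rewrite -sinD2pi; apply: sin_gt0_pi; rewrite -mulr_natl; apply/andP; split; lra.
have LE : L = [set t | pi < t < 2 * pi /\ inW t].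
  apply/seteqP; split => t; rewrite /L/= in_itv/= /lower_shadow/= half_chord_cos.
    move=> [t0 +]; rewrite ltr0_norm ?sin_lt0// mulrN opprK => ?.
    by split => //; split => //; exact: circle_cos_sin.
  by move=> [t0 []]; rewrite ltr0_norm ?sin_lt0// mulrN opprK.
have -> : theta W r x = mu (U `|` L `|` E).
  rewrite /theta UE LE; congr (mu _); apply/seteqP; split => t/=.
    move=> [/andP[t0 t2] Wt].
    have [te|tn0] := eqVneq t 0; first by right; split; [left|].
    have [te|tnpi] := eqVneq t pi; first by right; split; [right|].
    left; case: (ltgtP t pi) => [tpi|pit|tpi].
    - by left; split => //; rewrite lt_neqAle eq_sym tn0 t0.
    - by right; split => //; rewrite pit.
    - by rewrite tpi eqxx in tnpi.
  move=> [[[/andP[? ?] Wt]|[/andP[? ?] Wt]]|[[]-> Wt]]; split => //;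
    apply/andP; split; lra.
have mE : measurable E by exact: countable_measurable.
rewrite measureU0//; last 2 first.
- exact: measurableU.
- exact: countable_lebesgue_measure0.
rewrite measureU//; apply/seteqP; split => // t.
rewrite UE LE => -[[/andP[_ tpi] _] [/andP[pit _] _]].
by move: (lt_trans tpi pit); rewrite ltxx.
Qed.

End angular_measure.

(** * Delta integrals along a circle *)

Section delta_on_circle.
Context {R : realType}.
Variables (W : set (R * R)) (r : R) (x : R * R).
Hypotheses (W_closed : closed W) (r_gt0 : 0 < r).
Variables (g f : R * R -> R) (c k : R).
Hypotheses (c_ge0 : 0 <= c) (k_gt0 : 0 < k).
Hypothesis fE : forall y, W y -> f y = c.
Hypothesis g_zero : forall y, g y = 0 <-> eucl_dist y x = r.
Hypothesis g_deriv2 : forall y, g y = 0 -> deriv2 g y = (y.2 - x.2) / k.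
Local Notation mu := (@lebesgue_measure R).
Local Notation s := (half_chord r x.1).

Lemma circle_half_chord a b : eucl_dist (a, b) x = r <->
  `|a - x.1| <= r /\ (b = x.2 + s a \/ b = x.2 - s a).
Proof.
rewrite /eucl_dist/= /half_chord; split => [dr|[ar bE]].
  have r2 : r ^+ 2 = (a - x.1) ^+ 2 + (b - x.2) ^+ 2.
    by rewrite -dr sqr_sqrtr// addr_ge0// sqr_ge0.
  split.
    rewrite -(@ler_sqr R)// ?nnegrE ?(ltW r_gt0)//.
    by rewrite real_normK ?num_real// r2 lerDl sqr_ge0.
  rewrite r2 addrAC subrr add0r sqrtr_sqr.
  by case: (ger0P (b - x.2)) => _; [left|right]; ring.
have r2 : 0 <= r ^+ 2 - (a - x.1) ^+ 2.
  rewrite subr_ge0 -[X in X <= _]real_normK ?num_real// ler_sqr// ?nnegrE//.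
  exact: ltW.
have -> : (b - x.2) ^+ 2 = r ^+ 2 - (a - x.1) ^+ 2.
  by case: bE => ->; rewrite addrAC subrr add0r ?sqrrN sqr_sqrtr.
by rewrite addrC subrK sqrtr_sqr gtr0_norm.
Qed.

Let half_chord_near a : `|a - x.1| < r -> 0 < s a.
Proof. by rewrite ltr_distl => ?; exact: half_chord_gt0. Qed.

Let arc_density_far a : r <= `|a - x.1| -> arc_density r x.1 a = 0.
Proof. by move=> ra; rewrite arc_density_out// -ltr_distl -leNgt. Qed.

(** The discarded abscissae are those of the two vertical tangents. *)
Lemma simple_zeros_circle : simple_zeros g = [set a | `|a - x.1| != r].
Proof.
apply/seteqP; split => a /=.
  move=> h; apply/eqP => ar.
  have s0 : s a = 0.
    by rewrite /half_chord -[X in _ - X]real_normK ?num_real// ar subrr sqrtr0.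
  have g0 : g (a, x.2) = 0.
    by apply/g_zero/circle_half_chord; rewrite ar s0 addr0; split; [|left].
  by have := h _ g0; rewrite g_deriv2//= subrr mul0r eqxx.
move=> ar b gb; rewrite g_deriv2//= mulf_neq0 ?invr_neq0 ?(gt_eqF k_gt0)//.
have /g_zero/circle_half_chord[ar' bE] := gb.
have s_gt0 : 0 < s a by rewrite half_chord_near// lt_neqAle ar.
by case: bE => ->; rewrite addrAC subrr add0r ?oppr_eq0 (gt_eqF s_gt0).
Qed.

(** A vertical line meeting the open disc has two zeros of [g], at ordinates
    [x.2 + s a] and [x.2 - s a], and [`|deriv2 g|] is [s a / k] at both; a line
    missing the closed disc has none, and there [arc_density] is [0]. *)
Lemma inner_delta a : simple_zeros g a ->
  (\esum_(b in [set b | W (a, b) /\ g (a, b) = 0%R])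
       (f (a, b) / `|deriv2 g (a, b)|)%:E
   = (c * k)%:E * (((EFin \o arc_density r x.1) \_ (upper_shadow W r x)) a
                 + ((EFin \o arc_density r x.1) \_ (lower_shadow W r x)) a))%E.
Proof.
rewrite simple_zeros_circle/= => ar.
have [far|near] := leP r `|a - x.1|.
  rewrite (_ : [set b | _] = set0).
    rewrite esum_set0 /patch /= arc_density_far//.
    by case: ifP; case: ifP; rewrite adde0 mule0.
  apply/seteqP; split => b //= [_ /g_zero/circle_half_chord[ar' _]].
  by move: ar; rewrite eq_le far ar'.
have s_gt0 := half_chord_near near.
have weight (b : R) : W (a, b) -> `|b - x.2| = s a -> g (a, b) = 0 ->
    f (a, b) / `|deriv2 g (a, b)| = c * k * arc_density r x.1 a.
  move=> Wb bs g0; rewrite fE// g_deriv2//= normrM bs.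
  rewrite (gtr0_norm (_ : 0 < k^-1)) ?invr_gt0//.
  by rewrite /arc_density; field; rewrite !gt_eqF.
set G := (X in \esum_(b in _) X b).
have zerosE : [set b | W (a, b) /\ g (a, b) = 0] =
    ([set x.2 + s a] `|` [set x.2 - s a]) `&` [set b | W (a, b)].
  apply/seteqP; split => b/=.
    by move=> [Wb /g_zero/circle_half_chord[_ ?]].
  by move=> [bE Wb]; split => //; apply/g_zero/circle_half_chord; rewrite ltW.
rewrite zerosE esum_mkcondr esum_fset//; last first.
  by move=> b _; case: ifPn => // /set_mem Wb; rewrite /G lee_fin fE// divr_ge0.
rewrite fsbigU0//=; last first.
  by move=> b [/= -> ]; lra.
rewrite !fsbig_set1 ge0_muleDr; last 2 first.
- by rewrite /patch; case: ifP => // _; rewrite lee_fin arc_density_ge0.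
- by rewrite /patch; case: ifP => // _; rewrite lee_fin arc_density_ge0.
have term (b : R) (S : set R) :
    (W (a, b) <-> S a) -> `|b - x.2| = s a -> g (a, b) = 0 ->
    (if b \in [set b | W (a, b)] then G b else 0)%E
    = ((c * k)%:E * ((EFin \o arc_density r x.1) \_ S) a)%E.
  move=> WS bs g0; rewrite /patch; case: ifPn => [/set_mem Wb|/negP Wb].
    by rewrite mem_set; [rewrite /G weight|exact/WS].
  by rewrite memNset ?mule0// => /WS Wb'; apply: Wb; exact: mem_set.
have zero b : b = x.2 + s a \/ b = x.2 - s a -> g (a, b) = 0.
  by move=> bE; apply/g_zero/circle_half_chord; split => //; exact: ltW.
rewrite (term _ (upper_shadow W r x)).
- rewrite (term _ (lower_shadow W r x)).
  + by [].
  + by split.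
  + by rewrite addrAC subrr add0r normrN gtr0_norm.
  + by apply: zero; right.
- by split.
- by rewrite addrAC subrr add0r gtr0_norm.
- by apply: zero; left.
Qed.

Lemma delta_integral_circle : delta_integral W g f = ((c * k)%:E * theta W r x)%E.
Proof.
rewrite theta_shadows// /delta_integral.
pose w : R -> \bar R := EFin \o arc_density r x.1.
pose U := upper_shadow W r x; pose L := lower_shadow W r x.
have mU : measurable U by exact: measurable_upper_shadow.
have mL : measurable L by exact: measurable_lower_shadow.
have w_ge0 a : (0 <= w a)%E by rewrite lee_fin arc_density_ge0.
have wS_ge0 (S : set R) a : (0 <= (w \_ S) a)%E by apply: erestrict_ge0.
have mw (S : set R) : measurable S -> measurable_fun setT (w \_ S).
  move=> mS; apply/(measurable_restrictT w mS)/measurable_funTS/measurable_EFinP.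
  exact: measurable_arc_density.
transitivity (\int[mu]_(a in simple_zeros g)
    ((c * k)%:E * ((w \_ U) a + (w \_ L) a)))%E.
  by apply: eq_integral => a /set_mem; exact: inner_delta.
rewrite integral_mkcond.
(* At the two discarded abscissae the integrand is 0 anyway. *)
transitivity (\int[mu]_a ((c * k)%:E * ((w \_ U) a + (w \_ L) a)))%E.
  apply: eq_integral => a _; rewrite [LHS]patchE; case: ifPn => //.
  rewrite simple_zeros_circle notin_setE/= => /negP; rewrite negbK => /eqP ar.
  have wa0 : w a = 0%E by rewrite /w/= arc_density_far// ar.
  by rewrite !patchE wa0 !if_same adde0 mule0.
rewrite ge0_integralZl_EFin//; last 3 first.
- by move=> a _; exact: adde_ge0.
- by apply: emeasurable_funD; exact: mw.
- by rewrite mulr_ge0// ltW.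
rewrite ge0_integralD//; last 2 first.
- exact: mw.
- exact: mw.
by rewrite -!integral_mkcond.
Qed.

End delta_on_circle.

(** * The received power *)

Section received_power.
Context {R : realType}.
Variables (P d0 beta Pr r : R) (x : R * R).
Hypotheses (P_gt0 : 0 < P) (d0_gt0 : 0 < d0) (beta_gt0 : 0 < beta).
Hypotheses (Pr_gt0 : 0 < Pr) (Pr_ltP : Pr < P).
Hypothesis rE : r = ((P / Pr - 1) * d0) `^ (beta^-1).

Let g (y : R * R) : R := ln Pr - log_power P d0 beta x y.

Let ratio_gt0 : 0 < (P / Pr - 1) * d0.
Proof. by rewrite mulr_gt0// subr_gt0 ltr_pdivlMr// mul1r. Qed.

Lemma range_gt0 : 0 < r.
Proof. by rewrite rE powR_gt0// ratio_gt0. Qed.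

Lemma range_powR : r `^ beta = (P / Pr - 1) * d0.
Proof. by rewrite rE -powRrM mulVf ?gt_eqF// powRr1// ltW// ratio_gt0. Qed.

Let eucl_distC (y z : R * R) : eucl_dist y z = eucl_dist z y.
Proof. by rewrite /eucl_dist; congr Num.sqrt; ring. Qed.

Let den_gt0 (y : R * R) : 0 < d0 + eucl_dist x y `^ beta.
Proof. by rewrite ltr_pwDl// powR_ge0. Qed.

Lemma log_power_zero y : g y = 0 <-> eucl_dist y x = r.
Proof.
have P0 : 0 < P * d0 / (d0 + eucl_dist x y `^ beta).
  by rewrite divr_gt0 ?den_gt0// mulr_gt0.
rewrite eucl_distC /g /log_power; split => [/subr0_eq/ln_inj|yr].
  rewrite !posrE => /(_ Pr_gt0 P0) PrE.
  have : eucl_dist x y `^ beta = r `^ beta.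
    rewrite range_powR PrE; field.
    by rewrite !gt_eqF ?mulr_gt0 ?den_gt0.
  move=> /(congr1 (fun z => z `^ (beta^-1))).
  by rewrite -!powRrM mulfV ?gt_eqF// !powRr1 ?sqrtr_ge0// ltW// range_gt0.
apply/eqP; rewrite subr_eq0; apply/eqP; congr ln.
rewrite yr range_powR; field; rewrite !gt_eqF//.
by have := mulr_gt0 P_gt0 d0_gt0; lra.
Qed.

Lemma is_derive_eucl_dist a b : 0 < eucl_dist x (a, b) ->
  is_derive b 1 (fun b => eucl_dist x (a, b)) ((b - x.2) / eucl_dist x (a, b)).
Proof.
move=> d_gt0.
have q_gt0 : 0 < (x.1 - a) ^+ 2 + (x.2 - b) ^+ 2 by rewrite -sqrtr_gt0.
have dq : is_derive b 1 (fun b : R => (x.1 - a) ^+ 2 + (x.2 - b) ^+ 2)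
    (2 * (b - x.2)).
  by apply: is_derive_eq; rewrite /GRing.scale/=; ring.
have := @is_derive1_comp R Num.sqrt _ b _ _ (is_derive1_sqrt q_gt0) dq.
rewrite (_ : (_ * _) = (b - x.2) / eucl_dist x (a, b))//.
by rewrite /eucl_dist/=; field; rewrite gt_eqF.
Qed.

Lemma log_power_deriv2 y : g y = 0 ->
  deriv2 g y = (y.2 - x.2) / ((d0 + r `^ beta) / (beta * r `^ (beta - 2))).
Proof.
move=> /log_power_zero; rewrite eucl_distC; case: y => a b /= dr.
have r_gt0 := range_gt0.
rewrite /deriv2/=.
have -> : (fun b => g (a, b)) =
   (fun b => (ln Pr - ln (P * d0)) + ln (d0 + eucl_dist x (a, b) `^ beta)).
  apply/funext => b'; rewrite /g /log_power ln_div ?posrE ?mulr_gt0 ?den_gt0//.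
  by ring.
have dd := @is_derive_eucl_dist a b; rewrite dr in dd.
have d_gt0 : 0 < eucl_dist x (a, b) by rewrite dr.
have dp := @is_derive1_comp R (fun z => z `^ beta) (fun b => eucl_dist x (a, b))
  b _ _ (is_derive1_powR beta d_gt0) (dd r_gt0).
have ds : is_derive b 1 (fun b => d0 + eucl_dist x (a, b) `^ beta)
    (beta * r `^ (beta - 1) * ((b - x.2) / r)).
  rewrite dr in dp.
  by have := is_deriveD (is_derive_cst d0 b 1) dp; rewrite add0r.
have dl := @is_derive1_comp R (@ln R) _ b _ _ (is_derive1_ln (den_gt0 (a, b))) ds.
have dg : is_derive b 1
    (fun b => (ln Pr - ln (P * d0)) + ln (d0 + eucl_dist x (a, b) `^ beta))
    ((d0 + r `^ beta)^-1 * (beta * r `^ (beta - 1) * ((b - x.2) / r))).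
  rewrite dr in dl.
  by have := is_deriveD (is_derive_cst (ln Pr - ln (P * d0)) b 1) dl; rewrite add0r.
rewrite derive1E (@derive_val _ _ _ _ _ _ _ dg).
have -> : r `^ (beta - 1) = r `^ (beta - 2) * r.
  rewrite -[X in _ * X]powRr1 ?ltW// -powRD ?(gt_eqF r_gt0) ?implybT//.
  by congr (_ `^ _); ring.
field.
by rewrite !gt_eqF// ?powR_gt0// ltr_pwDl// powR_ge0.
Qed.

End received_power.

Lemma prior_probE {R : realType} (C W : set (R * R)) :
  measurable W -> W `<=` C -> (prior_prob C W = ((fine (area C))^-1)%:E * area W)%E.
Proof.
move=> mW WC; rewrite /prior_prob -integral_cst//; apply: eq_integral => y /set_mem Wy.
by rewrite /uniform_density indicE mem_set ?mul1r//; exact: WC.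
Qed.

Theorem mainTheorem2 (R : realType) (C W : set (R * R)) (A : R) (x : R * R)
    (P d0 beta Pr r : R)
    (C_region : compact_region C) (C_area : area C = A%:E)
    (W_region : compact_region W) (W_sub_C : W `<=` C)
    (P_gt0 : 0 < P) (d0_gt0 : 0 < d0) (beta_gt2 : 2 < beta)
    (Pr_gt0 : 0 < Pr) (Pr_ltP : Pr < P)
    (rE : r = ((P / Pr - 1) * d0) `^ (beta^-1)) :
  (cond_density P d0 beta C x W (ln Pr) * prior_prob C W
   = (A^-1)%:E *
     delta_integral W
       (fun y => ln Pr - ln (P * d0 / (d0 + eucl_dist x y `^ beta)))%R
       (fun _ => 1%R))%E
  /\
  (cond_density P d0 beta C x W (ln Pr) * prior_prob C W
   = ((d0 + r `^ beta) / (A * beta * r `^ (beta - 2)))%:E * theta W r x)%E.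
Proof.
have [W_compact W_area] := W_region; have [C_compact C_area_gt0] := C_region.
have [W_closed mW] := compact_closed_measurable_prod W_compact.
have [_ mC] := compact_closed_measurable_prod C_compact.
have A_gt0 : 0 < A by rewrite -lte_fin -C_area.
have W_area_lt : (area W < +oo)%E.
  rewrite (le_lt_trans _ (ltry A))// -C_area.
  by apply: le_measure => //; rewrite inE.
have beta_gt0 : 0 < beta by exact: lt_trans beta_gt2.
have r_gt0 := range_gt0 d0_gt0 Pr_gt0 Pr_ltP rE.
pose K := (d0 + r `^ beta) / (beta * r `^ (beta - 2)).
have K_gt0 : 0 < K.
  by rewrite divr_gt0 ?mulr_gt0 ?powR_gt0// ltr_pwDl// powR_ge0.
have deltaE f c : 0 <= c -> (forall y, W y -> f y = c) ->
    (delta_integral W (fun y => ln Pr - log_power P d0 beta x y)%R f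
     = (c * K)%:E * theta W r x)%E.
  move=> c_ge0 fc; apply: delta_integral_circle => //.
    by move=> y; exact: log_power_zero.
  by move=> y; exact: log_power_deriv2.
have -> : (cond_density P d0 beta C x W (ln Pr) * prior_prob C W
    = (A^-1 * K)%:E * theta W r x)%E.
  rewrite /cond_density.
  have probE : prior_prob C W = (A^-1 * fine (area W))%:E.
    by rewrite prior_probE// C_area/= EFinM fineK// ge0_fin_numE// ltW.
  have prob_gt0 : (0 < prior_prob C W)%E.
    by rewrite probE lte_fin mulr_gt0 ?invr_gt0// fine_gt0// W_area.
  rewrite -muleA mulVe ?mule1 ?gt_eqF//; last by rewrite probE.
  apply: deltaE => [|y Wy]; first by rewrite invr_ge0 ltW.
  by rewrite /uniform_density C_area/= indicE mem_set ?mul1r//; exact: W_sub_C.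
split.
  rewrite -[X in delta_integral W X]/(fun y => ln Pr - log_power P d0 beta x y).
  by rewrite (deltaE _ 1) ?ler01// mul1r muleA -EFinM.
congr (_%:E * _)%E; rewrite /K; field.
by rewrite !gt_eqF// ?powR_gt0.
Qed.
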